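(* Let $1<p\le2$ and $1<q<\infty$, and let $T:L^p(X)\to L^q(Y)$ be a bounded linear operator. Assume that there are constants $c_1\in(0,1]$ and $a>0$ such that $$\|T\|-\frac{\|T^\ast G\|_{p'}}{\|G\|_{q'}}\ \ge\ a\inf_{G_\ast\in M(T^\ast)}\left(\frac{\|G-G_\ast\|_{q'}}{\|G\|_{q'}}\right)^2$$ holds for every $G\in L^{q'}(Y)\setminus\{0\}$ with $$\inf_{G_\ast\in M(T^\ast)}\frac{\|G-G_\ast\|_{q'}}{\|G\|_{q'}}<c_1.$$ Then there are a constant $c_2\in(0,1]$ (with explicit dependence on $p,q,\|T\|$ and $c_1$) and a constant $b>0$ (independent of $g$) such that, if $g\in L^p(X)\setminus\{0\}$ satisfies $$\inf_{g_\ast\in M(T)}\frac{\|g-g_\ast\|_p}{\|g\|_p}<c_2,$$ then $$\|T\|-\frac{\|Tg\|_q}{\|g\|_p}\ \ge\ b\inf_{g_\ast\in M(T)}\left(\frac{\|g-g_\ast\|_p}{\|g\|_p}\right)^2.$$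
   Context: $X$ and $Y$ are measure spaces, $L^p(X)$, $L^q(Y)$ are the usual (complex) Lebesgue spaces, and $\|\cdot\|_r$ denotes the $L^r$ norm. For an exponent $r$, $r'=\frac{r}{r-1}$ is the Hölder conjugate. $T^\ast:L^{q'}(Y)\to L^{p'}(X)$ is the adjoint of $T$, and $\|T\|$ is the operator norm. For a bounded linear operator $A$ from $L^{a}$ to $L^{b}$, $M(A)$ denotes its set of extremisers, i.e. $\{g\in L^a\setminus\{0\}:\|Ag\|_{L^b}=\|A\|\,\|g\|_{L^a}\}$. An infimum over the empty set is $+\infty$. *)

(* Defs.v *)
From HB Require Import structures.
From mathcomp Require Import all_boot all_order all_algebra.
From mathcomp Require Import generic_quotient ring_quotient.
From mathcomp Require Import complex.
From mathcomp Require Import all_classical all_reals all_analysis.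
From mathcomp Require Import ess_sup_inf measurable_realfun.

Set Implicit Arguments.
Unset Strict Implicit.
Unset Printing Implicit Defensive.
Import Order.TTheory GRing.Theory Num.Theory.
Import numFieldNormedType.Exports.

Local Open Scope classical_set_scope.
Local Open Scope ring_scope.

Local Notation C R := (R[i])%type.
(* The modulus as a real number; `|z| : R[i] would be complex-valued. *)
Local Notation normc := (@ComplexField.Normc.normc _).

(* The library's Lfun, LfunType and LspaceType are for real-valued functions,
   and LspaceType carries no vector space structure.  What follows is the
   complex-valued analogue, with the same parameters (an extended real p and
   a proof p1 that p >= 1). *)
Section cLfun.
Context d (T : measurableType d) (R : realType).
Variables (mu : {measure set T -> \bar R}) (p : \bar R) (p1 : (1 <= p)%E).
Implicit Types f g : T -> C R.

Definition cmeasurable f :=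
  measurable_fun setT (fun x => complex.Re (f x)) /\
  measurable_fun setT (fun x => complex.Im (f x)).

Definition cLfun of (1 <= p)%E : {pred T -> C R} :=
  [pred f | `[< cmeasurable f /\ finite_norm mu p (normc \o f) >]].

Lemma cLfunP f : reflect (cmeasurable f /\ finite_norm mu p (normc \o f))
  (f \in cLfun p1).
Proof. exact: asboolP. Qed.

Lemma measurable_normc f : cmeasurable f -> measurable_fun setT (normc \o f).
Proof.
move=> [mr mi].
have -> : normc \o f = (fun x =>
    Num.sqrt (complex.Re (f x) ^+ 2 + complex.Im (f x) ^+ 2)).
  by apply/funext => x /=; case: (f x).
apply: (measurableT_comp (f := @Num.sqrt R)).
  by apply: continuous_measurable_fun; exact: sqrt_continuous.
by apply: measurable_funD; exact: measurable_funX.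
Qed.

Lemma le_finite_norm (u v : T -> R) :
  measurable_fun setT u -> measurable_fun setT v ->
  (forall x, 0 <= u x <= v x) -> finite_norm mu p v -> finite_norm mu p u.
Proof.
move=> mu_ mv uv; apply: le_lt_trans.
have uv' x : (`|(u x)%:E| <= `|(v x)%:E|)%E.
  have /andP[u0 uvx] := uv x.
  by rewrite !gee0_abs ?lee_fin// (le_trans u0).
rewrite unlock /Lnorm; case: p p1 => [r r1|_|//]; last first.
  by case: ifPn => // _; apply: le_ess_sup; exact: nearW.
have r0 : 0 <= r by rewrite (le_trans ler01)// -lee_fin.
apply: gt0_ler_poweR; rewrite ?invr_ge0//.
- by rewrite in_itv/= integral_ge0//= leey.
- by rewrite in_itv/= integral_ge0//= leey.
apply: ge0_le_integral => //.
- by move=> *; exact: poweR_ge0.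
- apply: (measurableT_comp (measurable_poweR r)).
  by apply: measurableT_comp => //; apply/measurable_EFinP.
- apply: (measurableT_comp (measurable_poweR r)).
  by apply: measurableT_comp => //; apply/measurable_EFinP.
- move=> x _; apply: gt0_ler_poweR => //; last exact: uv'.
  + by rewrite in_itv/= leey andbT lee_fin.
  + by rewrite in_itv/= leey andbT lee_fin.
Qed.

Lemma cLfun_submod_closed : submod_closed (cLfun p1).
Proof.
have LfunP f : cmeasurable f -> finite_norm mu p (normc \o f) ->
    normc \o f \in Lfun mu p.
  move=> mf ff; rewrite inE /=; apply/andP; split; rewrite inE //.
  exact: measurable_normc.
split.
  apply/cLfunP; split.
    by split; exact: measurable_cst.
  rewrite (_ : normc \o _ = cst 0); first exact: finite_norm_cst0.
  by apply/funext => x /=; exact: ComplexField.Normc.normc0.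
move=> a f g /cLfunP[mf ff] /cLfunP[mg fg].
have mafg : cmeasurable (a *: f + g).
  case: mf mg => [fr fi] [gr gi]; split.
    rewrite (_ : (fun x => _) = (fun x =>
      complex.Re a * complex.Re (f x) - complex.Im a * complex.Im (f x)
      + complex.Re (g x))); last first.
      by apply/funext => x; rewrite !fctE; case: a (f x) (g x) => [? ?] [? ?] [].
    apply: measurable_funD => //; apply: measurable_funB;
      exact: measurable_funM.
  rewrite (_ : (fun x => _) = (fun x =>
    complex.Re a * complex.Im (f x) + complex.Im a * complex.Re (f x)
    + complex.Im (g x))); last first.
    by apply/funext => x; rewrite !fctE; case: a (f x) (g x) => [? ?] [? ?] [].
  apply: measurable_funD => //; apply: measurable_funD;
    exact: measurable_funM.
apply/cLfunP; split => //.
have := Lfun_submod_closed mu p1 => -[_ /(_ (normc a) _ _ (LfunP f mf ff)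
  (LfunP g mg fg))].
rewrite inE => /andP[]; rewrite !inE => mh; apply: le_finite_norm => //.
  exact: measurable_normc.
move=> x /=; rewrite !fctE.
by rewrite -[_ *: normc _]/(normc a * normc (f x))
  -ComplexField.Normc.normcM le_normcD andbT; case: (_ + _) => u v; exact: sqrtr_ge0.
Qed.

HB.instance Definition _ :=
  GRing.isSubmodClosed.Build _ _ (cLfun p1) cLfun_submod_closed.

End cLfun.

Section cLspace.
Context d (T : measurableType d) (R : realType).
Variables (mu : {measure set T -> \bar R}) (p : \bar R) (p1 : (1 <= p)%E).

Record cLfunType := CLfun {
  cLfun_fun :> T -> C R;
  cLfun_prop : cLfun_fun \in cLfun mu p1 }.

HB.instance Definition _ := [isSub for cLfun_fun].
HB.instance Definition _ := gen_eqMixin cLfunType.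
HB.instance Definition _ := [Choice of cLfunType by <:].
HB.instance Definition _ := [SubChoice_isSubLmodule of cLfunType by <:].

Definition null_fun : {pred cLfunType} :=
  [pred f : cLfunType | `[< \forall x \ae mu, f x = 0 >]].

Lemma null_funP (f : cLfunType) :
  reflect (\forall x \ae mu, f x = 0) (f \in null_fun).
Proof. exact: asboolP. Qed.

Lemma null_fun_submod_closed : submod_closed null_fun.
Proof.
split; first by apply/null_funP; exact: nearW.
move=> a f g /null_funP f0 /null_funP g0; apply/null_funP.
apply: filterS2 f0 g0 => x fx gx.
by rewrite -[LHS]/(a * f x + g x) fx gx mulr0 addr0.
Qed.

HB.instance Definition _ :=
  GRing.isSubmodClosed.Build _ _ null_fun null_fun_submod_closed.

(* The quotient of the vector space of p-integrable functions by its subspace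
   of null functions. *)
Definition cLspace : Type := Quotient.quot null_fun.

HB.instance Definition _ := Choice.on cLspace.
HB.instance Definition _ := GRing.Zmodule.on cLspace.
HB.instance Definition _ : EqQuotient _ (Quotient.equiv null_fun) cLspace :=
  EqQuotient.on cLspace.

Local Open Scope quotient_scope.

Lemma cLspace_eqP (f g : cLfunType) :
  \pi_cLspace f = \pi_cLspace g <-> \forall x \ae mu, f x = g x.
Proof.
rewrite (rwP eqP) -[_ == _]/(f == g %[mod Quotient.quot null_fun]).
rewrite -Quotient.idealrBE -(rwP (null_funP _)).
split; apply: filterS => x; rewrite -[(f - g) x]/(f x - g x).
  by move/eqP; rewrite subr_eq0 => /eqP.
by move=> ->; rewrite subrr.
Qed.

Lemma cLspace_piD (f g : cLfunType) :
  \pi_cLspace (f + g) = \pi_cLspace f + \pi_cLspace g.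
Proof. exact: Quotient.pi_add. Qed.

(* repr u is an arbitrary representative of the class u; cLspace_piZ and
   cLnorm_pi show independence of that choice. *)
Definition cLspace_scale (a : C R) (u : cLspace) : cLspace :=
  \pi_cLspace (a *: repr u).

Lemma cLspace_piZ a (f : cLfunType) :
  \pi_cLspace (a *: f) = cLspace_scale a (\pi_cLspace f).
Proof.
apply/cLspace_eqP.
have : \forall x \ae mu, f x = repr (\pi_cLspace f) x.
  by apply (proj1 (cLspace_eqP _ _)); rewrite reprK.
by apply: filterS => x fx; rewrite -[LHS]/(a * f x) fx.
Qed.

Let scaleA a b u :
  cLspace_scale a (cLspace_scale b u) = cLspace_scale (a * b) u.
Proof.
by rewrite -[u]reprK -(cLspace_piZ b) -(cLspace_piZ a) -cLspace_piZ scalerA.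
Qed.

Let scale1 : left_id 1 cLspace_scale.
Proof. by move=> u; rewrite -[u]reprK -cLspace_piZ scale1r. Qed.

Let scaleDr : right_distributive cLspace_scale +%R.
Proof.
move=> a u v; rewrite -[u]reprK -[v]reprK -cLspace_piD -(cLspace_piZ a (_ + _)).
by rewrite scalerDr cLspace_piD !cLspace_piZ.
Qed.

Let scaleDl u : {morph cLspace_scale^~ u : a b / a + b}.
Proof.
by move=> a b; rewrite -[u]reprK -!cLspace_piZ -cLspace_piD -scalerDl !cLspace_piZ.
Qed.

HB.instance Definition _ := GRing.Zmodule_isLmodule.Build (C R) cLspace
  scaleA scale1 scaleDr scaleDl.

Definition cLnorm (u : cLspace) : R :=
  fine ('N[mu]_p[EFin \o (normc \o repr u)])%E.

Lemma cLnorm_pi (f : cLfunType) :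
  cLnorm (\pi_cLspace f) = fine ('N[mu]_p[EFin \o (normc \o f)])%E.
Proof.
have fg : \forall x \ae mu, repr (\pi_cLspace f) x = f x.
  by apply (proj1 (cLspace_eqP _ _)); rewrite reprK.
have mf (h : cLfunType) : measurable_fun setT (normc \o h).
  have [mh _] := elimT (cLfunP _ _ _) (cLfun_prop h).
  exact: measurable_normc.
congr fine; rewrite unlock /Lnorm; case: p p1 f fg mf => [r r1|r1|//] f fg mf.
  congr (_ `^ _)%E; apply: ae_eq_integral => //.
  - apply: (measurableT_comp (measurable_poweR r)).
    by apply: measurableT_comp => //; apply/measurable_EFinP; exact: mf.
  - apply: (measurableT_comp (measurable_poweR r)).
    by apply: measurableT_comp => //; apply/measurable_EFinP; exact: mf.
  - by apply: filterS fg => x fx _; rewrite /= fx.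
case: ifPn => // _; apply: eq_ess_sup.
by apply: filterS fg => x fx; rewrite /= fx.
Qed.

End cLspace.

Section pairing.
Context d (T : measurableType d) (R : realType).
Variable mu : {measure set T -> \bar R}.

Definition cintegral (f : T -> C R) : C R :=
  Complex (\int[mu]_x complex.Re (f x)) (\int[mu]_x complex.Im (f x)).

(* Linear in u and antilinear in v, so that the adjoint below is C-linear, as
   for Hilbert spaces; the product is integrable by Hoelder's inequality. *)
Definition cpairing (p : \bar R) (p1 : (1 <= p)%E)
    (u : cLspace mu p1) (v : cLspace mu (hoelder_conj_ge1 p1)) : C R :=
  cintegral (fun x => repr u x * conjc (repr v x)).

End pairing.

Section operators.
Context dX dY (X : measurableType dX) (Y : measurableType dY) (R : realType).
Variables (mu : {measure set X -> \bar R}) (nu : {measure set Y -> \bar R}).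
Variables (p q : \bar R) (p1 : (1 <= p)%E) (q1 : (1 <= q)%E).
Implicit Types A : cLspace mu p1 -> cLspace nu q1.

Definition bounded_op A := exists M : R, forall u, cLnorm (A u) <= M * cLnorm u.

(* Meaningful when A is bounded and homogeneous: sup is 0 on unbounded sets. *)
Definition opnorm A : R := sup [set cLnorm (A u) | u in [set u | cLnorm u <= 1]].

Definition extremisers A : set (cLspace mu p1) :=
  [set g | g != 0 /\ cLnorm (A g) = opnorm A * cLnorm g].

(* Since L^p' is the dual of L^p for 1 < p < oo, this determines As uniquely,
   and such an As exists when A is linear and bounded and 1 < p, q < oo. *)
Definition is_adjoint A
    (As : cLspace nu (hoelder_conj_ge1 q1) -> cLspace mu (hoelder_conj_ge1 p1)) :=
  forall f G, cpairing (A f) G = cpairing f (As G).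

End operators.

(* Main.v *)
Require Import Defs.
From mathcomp Require Import all_boot all_order all_algebra.
From mathcomp Require Import generic_quotient.
From mathcomp Require Import complex.
From mathcomp Require Import all_classical all_reals all_analysis.
From mathcomp Require Import measurable_realfun.
From mathcomp Require Import ring lra.

Set Implicit Arguments.
Unset Strict Implicit.
Unset Printing Implicit Defensive.
Import Order.TTheory GRing.Theory Num.Theory.
Local Open Scope classical_set_scope.
Local Open Scope ring_scope.

(* Write Ts for the adjoint.  For g in L^p let G in L^q' be a unit vector norming
   Tg, and u = Ts G.  The deficit of g splits as
   (||T|| - ||u||) + (||u|| - Re <g, u> / ||g||).  The first term is the deficit
   of G for Ts, hence controls the distance of G to M(Ts).  If Gs is in M(Ts) and
   k norms v = Ts Gs then k is in M(T), and 2-uniform convexity of L^p (p <= 2)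
   bounds the distance from g / ||g|| to k by ||G - Gs|| and the second term.
   Uniform convexity of L^q' makes G close to M(Ts) when g is close to M(T). *)

(** The two duality maps play different roles. The one from Tg to G lands in L^q' and is in general
    only Hoelder continuous, so closeness of G to M(Ts) serves only to enter the region where the
    hypothesis applies; a modulus of convexity of any power suffices there, and it fixes c2. The
    quadratic estimate runs the other way, from Gs to k, where the map lands in L^p, whose convexity
    has power type 2 for p <= 2. Distances to M(T) and M(Ts) need not be attained, so the estimate
    is proved for an arbitrary Gs and the infimum is taken at the end. Real parts of pairings
    suffice, because they obey Hoelder's inequality and attain it at norming vectors. Exponents are
    extended reals with an equation [p = r%:E], since the dual space is typed by
    [hoelder_conjugate p], which equals a real exponent only propositionally. *)

Local Notation normc := (@ComplexField.Normc.normc _).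

(** * Scalar inequalities for real powers *)

Section pointwise.
Context {R : realType}.
Implicit Types (a b d m r s t u x : R).

(** Young's inequality for x^t and 1 with the exponents 1/t and 1/(1-t). *)
Lemma powR_le_tangent x t : 0 <= x -> 0 <= t <= 1 -> x `^ t <= 1 + t * (x - 1).
Proof.
move=> x0 /andP[]; rewrite le_eqVlt => /predU1P[<- _|t0].
  by rewrite powRr0 mul0r addr0.
rewrite le_eqVlt => /predU1P[->|t1]; first by rewrite powRr1//; lra.
have := @conjugate_powR _ (x `^ t) 1 t^-1 (1 - t)^-1 (powR_ge0 _ _) ler01.
rewrite !invr_gt0 subr_gt0 !invrK => /(_ t0 t1) H.
have /H : t + (1 - t) = 1 by ring.
by rewrite powR1 mulr1 -powRrM mulfV ?gt_eqF// powRr1// => /le_trans; apply; lra.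
Qed.

(* u^r = u^2 / u^(2-r), and u^(2-r) lies below its tangent at 1. *)
Lemma powR_ge_quadratic r u : 1 < r <= 2 -> 0 <= u <= 2 ->
  1 + r * (u - 1) + (r - 1) ^+ 2 / 2 * (u - 1) ^+ 2 <= u `^ r.
Proof.
move=> /andP[r1 r2] /andP[]; rewrite le_eqVlt => /predU1P[<- _|u0 u2].
  rewrite powR0 ?gt_eqF ?(lt_trans ltr01)//.
  have : (r - 1) * (r - 1) <= (r - 1) * 1 by apply: ler_wpM2l; lra.
  by rewrite expr2; lra.
have t01 : 0 <= 2 - r <= 1 by apply/andP; split; lra.
have := powR_le_tangent (ltW u0) t01; set L := 1 + _ => uL.
have p0 : 0 < u `^ (2 - r) by exact: powR_gt0.
have L0 : 0 < L by exact: lt_le_trans uL.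
have L2 : L <= 2.
  have : (2 - r) * (u - 1) <= (2 - r) * 1 by apply: ler_wpM2l; lra.
  by rewrite /L; lra.
have uu : u `^ r * u `^ (2 - r) = u ^+ 2.
  rewrite -powRD ?(gt_eqF u0) ?implybT// -(powR_mulrn _ (ltW u0)).
  by congr (_ `^ _); ring.
have rE : u `^ r = u ^+ 2 / u `^ (2 - r) by rewrite -uu mulfK// gt_eqF.
apply: (@le_trans _ _ (u ^+ 2 / L)); last first.
  by rewrite rE ler_wpM2l ?sqr_ge0// lef_pV2 ?posrE.
rewrite ler_pdivlMr//.
have -> : u ^+ 2 = (1 + r * (u - 1)) * L + (r - 1) ^+ 2 * (u - 1) ^+ 2.
  by rewrite /L; ring.
rewrite mulrDl lerD2l.
have -> : (r - 1) ^+ 2 / 2 * (u - 1) ^+ 2 * L =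
    ((r - 1) ^+ 2 * (u - 1) ^+ 2) * (L / 2) by field.
rewrite ler_piMr ?(mulr_ge0 (sqr_ge0 _) (sqr_ge0 _))//.
by rewrite ler_pdivrMr ?mul1r.
Qed.

Lemma powR_sqr_half x r : 0 <= x -> x `^ r = (x ^+ 2) `^ (r / 2).
Proof.
move=> x0; rewrite -(powR_mulrn 2 x0) -powRrM; congr (_ `^ _).
by rewrite mulrC divfK.
Qed.

(* Here a, b, m, d stand for |z|, |w|, |z + w|/2 and |z - w|/2. *)
Lemma powR_parallelogram_le2 r a b m d t : 1 < r <= 2 ->
  0 <= a -> 0 <= b -> 0 <= m -> 0 <= d -> 0 < t ->
  m ^+ 2 + d ^+ 2 = (a ^+ 2 + b ^+ 2) / 2 -> m <= (a + b) / 2 ->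
  m `^ r + (r - 1) ^+ 2 / 2 *
    (t `^ (2 - r) * d `^ r - t ^+ 2 * ((a `^ r + b `^ r) / 2))
  <= (a `^ r + b `^ r) / 2.
Proof.
move=> r12 a0 b0 m0 d0 t0 E ms.
have /andP[r1 r2] := r12.
have r0 : r != 0 by rewrite gt_eqF// (lt_trans ltr01).
have [s0|s_neq0] := eqVneq (a + b) 0.
  have az : a = 0 by lra. have bz : b = 0 by lra. have mz : m = 0 by lra.
  move: E; rewrite az bz mz !expr0n/= !(add0r, addr0) mul0r => /eqP.
  by rewrite expf_eq0/= => /eqP ->; rewrite powR0// addr0 mul0r !mulr0 subr0 mulr0 addr0.
(* By homogeneity the mean of a and b becomes 1: the pair turns into 1 + x and 1 - x, with m' <=
   1. *)
pose s := (a + b) / 2.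
have s0 : 0 < s by rewrite divr_gt0// lt0r s_neq0 addr_ge0.
pose x := (a - b) / (a + b).
have aE : a = s * (1 + x) by rewrite /s /x; field.
have bE : b = s * (1 - x) by rewrite /s /x; field.
have sn : s != 0 by rewrite gt_eqF.
pose m' := m / s; pose d' := d / s.
have mE : m = s * m' by rewrite /m'; field.
have dE : d = s * d' by rewrite /d'; field.
have x1 : 0 <= 1 + x by move: a0; rewrite aE pmulr_rge0.
have x2 : 0 <= 1 - x by move: b0; rewrite bE pmulr_rge0.
have m'0 : 0 <= m' by rewrite divr_ge0// ltW.
have d'0 : 0 <= d' by rewrite divr_ge0// ltW.
have m'1 : m' <= 1 by rewrite ler_pdivrMr// mul1r.
have E' : m' ^+ 2 + d' ^+ 2 = 1 + x ^+ 2.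
  apply: (mulfI (x := s ^+ 2)); first by rewrite expf_eq0 negb_and sn orbT.
  by rewrite mulrDr -!exprMn -mE -dE E [in LHS]aE [in LHS]bE; field.
clearbody x m' d' s.
have ga := @powR_ge_quadratic r (1 + x) r12.
have gb := @powR_ge_quadratic r (1 - x) r12.
have : 0 <= 1 + x <= 2 by lra.
move/ga => {ga}; rewrite (_ : 1 + x - 1 = x); last ring.
move=> ga.
have : 0 <= 1 - x <= 2 by lra.
move/gb => {gb}; rewrite (_ : 1 - x - 1 = - x); last ring.
rewrite sqrrN => gb.
have gm : m' `^ r <= 1 + r / 2 * (m' ^+ 2 - 1).
  by rewrite powR_sqr_half//; apply: powR_le_tangent; rewrite ?sqr_ge0//; lra.
have m'2 : m' ^+ 2 <= 1 by rewrite expr_le1.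
set k := (r - 1) ^+ 2 / 2 in ga gb *.
have k0 : 0 <= k by rewrite divr_ge0 ?sqr_ge0.
have kr : k <= r / 2.
  rewrite /k ler_pM2r ?invr_gt0//.
  have : (r - 1) * (r - 1) <= 1 * (r - 1) by apply: ler_wpM2r; lra.
  by rewrite expr2; lra.
(* The linear terms at 1 + x and 1 - x cancel in the mean, which is thus at least 1 + k x^2. The
   tangent bound for m' gains r/2 (1 - m'^2), and k <= r/2. *)
have key : m' `^ r + k * d' ^+ 2 <= ((1 + x) `^ r + (1 - x) `^ r) / 2.
  have : k * (1 - m' ^+ 2) <= r / 2 * (1 - m' ^+ 2).
    by apply: ler_wpM2r => //; lra.
  have -> : d' ^+ 2 = 1 + x ^+ 2 - m' ^+ 2 by rewrite -E' addrAC subrr add0r.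
  move: gm ga gb; lra.
have one : 1 <= ((1 + x) `^ r + (1 - x) `^ r) / 2.
  have : 0 <= k * x ^+ 2 by rewrite mulr_ge0 ?sqr_ge0.
  by move: ga gb; lra.
(* If t <= d', then t^(2-r) <= d'^(2-r); otherwise the left side is at most 0. *)
have td : t `^ (2 - r) * d' `^ r - t ^+ 2 <= d' ^+ 2.
  have pw y : 0 <= y -> y `^ (2 - r) * y `^ r = y ^+ 2.
    move=> y0; rewrite -powRD; first by rewrite subrK powR_mulrn.
    by rewrite subrK pnatr_eq0.
  have [td|dt] := leP t d'.
    apply: (@le_trans _ _ (d' `^ (2 - r) * d' `^ r)); last by rewrite pw.
    rewrite lerBlDr; apply: (@le_trans _ _ (d' `^ (2 - r) * d' `^ r)).
      rewrite ler_wpM2r ?powR_ge0//; apply: ge0_ler_powR; rewrite ?nnegrE//; lra.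
    by rewrite lerDl sqr_ge0.
  apply: (@le_trans _ _ 0); last exact: sqr_ge0.
  rewrite subr_le0 -(pw t (ltW t0)) ler_wpM2l ?powR_ge0//.
  by apply: ge0_ler_powR; rewrite ?nnegrE ?(ltW dt) ?(ltW t0)//; lra.
rewrite aE bE mE dE !powRM// ?(ltW s0)//.
set W := s `^ r; have W0 : 0 <= W by exact: powR_ge0.
set P := ((1 + x) `^ r + (1 - x) `^ r) / 2 in key one.
have -> : (W * (1 + x) `^ r + W * (1 - x) `^ r) / 2 = W * P by rewrite /P; field.
have -> : W * m' `^ r + k * (t `^ (2 - r) * (W * d' `^ r) - t ^+ 2 * (W * P)) =
  W * (m' `^ r + k * (t `^ (2 - r) * d' `^ r - t ^+ 2 * P)) by ring.
rewrite ler_wpM2l//; apply: le_trans key; rewrite lerD2l ler_wpM2l//.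
apply: le_trans td; rewrite lerD2l lerN2.
by rewrite ler_peMr ?sqr_ge0.
Qed.

(** Because x^r = x * x^(r-1) <= x * (x + u)^(r-1), and likewise for u. *)
Lemma powR_superadd x u r : 0 <= x -> 0 <= u -> 1 <= r ->
  x `^ r + u `^ r <= (x + u) `^ r.
Proof.
move=> x0 u0 r1; have r0 : 0 < r by exact: lt_le_trans r1.
rewrite -(mulr_powRB1 x0 r0) -(mulr_powRB1 u0 r0).
rewrite -(mulr_powRB1 (addr_ge0 x0 u0) r0) mulrDl lerD// ler_wpM2l//;
  by apply: ge0_ler_powR; rewrite ?nnegrE ?subr_ge0 ?(addr_ge0 x0 u0) ?lerDl ?lerDr.
Qed.

Lemma powR_midpoint_le x u r : 0 <= x -> 0 <= u -> 1 <= r ->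
  ((x + u) / 2) `^ r <= (x `^ r + u `^ r) / 2.
Proof.
move=> x0 u0 r1.
have h : (0 : R) <= 2^-1 by rewrite invr_ge0.
have h' : (2^-1 : R) <= 1 by rewrite invf_le1// ler1n.
have := @convex_powR _ r r1 (Itv01 h h') x u.
rewrite !inE/= !in_itv/= !andbT => /(_ x0 u0).
rewrite convRE -[conv _ _ _]/(2^-1 * x + (1 - 2^-1) * u) /= /unstable.onem.
rewrite (_ : 1 - 2^-1 = 2^-1 :> R); last by field.
by rewrite ![2^-1 * _]mulrC -!mulrDl.
Qed.

(** Superadditivity and then convexity of the power r/2 >= 1, applied to squares. *)
Lemma powR_parallelogram_ge2 r a b m d : 2 <= r ->
  0 <= a -> 0 <= b -> 0 <= m -> 0 <= d ->
  m ^+ 2 + d ^+ 2 = (a ^+ 2 + b ^+ 2) / 2 ->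
  m `^ r + d `^ r <= (a `^ r + b `^ r) / 2.
Proof.
move=> r2 a0 b0 m0 d0 E.
rewrite (powR_sqr_half r m0) (powR_sqr_half r d0) (powR_sqr_half r a0).
rewrite (powR_sqr_half r b0).
have r1 : 1 <= r / 2 by lra.
apply: le_trans (powR_superadd (sqr_ge0 _) (sqr_ge0 _) r1) _.
by rewrite E powR_midpoint_le ?sqr_ge0.
Qed.

End pointwise.

(** * Modulus and real inner product of complex numbers *)

Section normc.
Context {R : realType}.
Implicit Types z w : R[i].

Lemma normc_ge0 z : 0 <= normc z.
Proof. by case: z => x y; exact: sqrtr_ge0. Qed.

Lemma sqr_normc z : normc z ^+ 2 = complex.Re z ^+ 2 + complex.Im z ^+ 2.
Proof. by case: z => x y; rewrite sqr_sqrtr// addr_ge0 ?sqr_ge0. Qed.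

Lemma normc_real (x : R) : normc x%:C%C = `|x|.
Proof. by rewrite /= expr0n/= addr0 sqrtr_sqr. Qed.

Lemma normc_parallelogram z w : (normc (z + w) / 2) ^+ 2 + (normc (z - w) / 2) ^+ 2
  = (normc z ^+ 2 + normc w ^+ 2) / 2.
Proof. by rewrite !expr_div_n !sqr_normc; case: z w => [a b] [c e] /=; field. Qed.

Definition cdot z w := complex.Re z * complex.Re w + complex.Im z * complex.Im w.

Lemma cdotE z w : cdot z w = complex.Re (z * conjc w).
Proof. by rewrite /cdot; case: z w => [a b] [c e] /=; ring. Qed.

(** Lagrange's identity: the difference of the squares of both sides is itself a square. *)
Lemma cdot_norm z w : `|cdot z w| <= normc z * normc w.
Proof.
rewrite -ler_sqr ?nnegrE ?mulr_ge0 ?normc_ge0// real_normK ?num_real//.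
rewrite exprMn !sqr_normc /cdot -subr_ge0.
set x := (X in 0 <= X).
have -> : x = (complex.Re z * complex.Im w - complex.Im z * complex.Re w) ^+ 2.
  by rewrite /x; ring.
exact: sqr_ge0.
Qed.

End normc.

(** * The norm of the complex Lebesgue space *)

Section one_space.
Local Open Scope quotient_scope.
Context d (T : measurableType d) (R : realType).
Variables (mu : {measure set T -> \bar R}) (p : \bar R) (p1 : (1 <= p)%E).
Variable r : R.
Hypotheses (pr : p = r%:E) (r1 : 1 < r).
Implicit Types (f g : cLfunType mu p1) (u v : cLspace mu p1).

Let r0 : 0 < r. Proof. exact: lt_trans r1. Qed.

Lemma cLfun_cmeasurable f : cmeasurable f.
Proof. by have /cLfunP[] := cLfun_prop f. Qed.

Lemma cLfun_in_Lfun f : normc \o f \in Lfun mu r%:E.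
Proof.
have /cLfunP[mf ff] := cLfun_prop f.
by rewrite -pr inE; apply/andP; split; rewrite inE//; exact: measurable_normc.
Qed.

Lemma integrable_powR_normc f :
  mu.-integrable setT (fun x => (normc (f x) `^ r)%:E).
Proof.
have := Lfun_integrable (ltW r1) (cLfun_in_Lfun f).
by apply: eq_integrable => // x _ /=; rewrite ger0_norm// normc_ge0.
Qed.

Lemma cLnorm_ge0 u : 0 <= cLnorm u.
Proof. by rewrite fine_ge0// Lnorm_ge0. Qed.

(** Trades norms for real integrals of r-th powers, so that pointwise inequalities can be integrated
    without taking roots. *)
Lemma powR_cLnorm f :
  cLnorm (\pi_(cLspace mu p1) f) `^ r = \int[mu]_x (normc (f x) `^ r).
Proof.
have /cLfunP[mf ff] := cLfun_prop f.
rewrite cLnorm_pi /Rintegral.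
set N := Lnorm _ _ _.
have NE : N = Lnorm mu r%:E (EFin \o (normc \o f)) by rewrite -pr.
have N0 : (0 <= N)%E by exact: Lnorm_ge0.
have Nf : N \is a fin_num by rewrite ge0_fin_numE.
have /(congr1 fine)/= -> : ((fine N `^ r)%:E = 'N[mu]_r%:E[EFin \o (normc \o f)] `^ r)%E.
  by rewrite -poweR_EFin fineK// NE.
have rn0 : r != 0 by rewrite gt_eqF.
rewrite (poweR_Lnorm _ _ rn0).
congr fine.
apply: eq_integral => x _.
rewrite /=.
by rewrite ger0_norm ?normc_ge0.
Qed.

Lemma cLspaceW (P : cLspace mu p1 -> Prop) :
  (forall f, P (\pi_(cLspace mu p1) f)) -> forall u, P u.
Proof. by move=> Pf u; rewrite -[u]reprK; exact: Pf. Qed.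

Lemma cLnormZ (a : R[i]) u : cLnorm (a *: u) = normc a * cLnorm u.
Proof.
elim/cLspaceW: u => f.
rewrite -[_ *: _]/(cLspace_scale a (\pi_(cLspace mu p1) f)) -cLspace_piZ.
apply: (powR_injective r0); rewrite ?nnegrE ?mulr_ge0 ?cLnorm_ge0 ?normc_ge0//.
rewrite powRM ?cLnorm_ge0 ?normc_ge0// !powR_cLnorm.
rewrite -RintegralZl//; last exact: integrable_powR_normc.
apply: eq_Rintegral => x _.
by rewrite -[(a *: f) x]/(a * f x) ComplexField.Normc.normcM powRM ?normc_ge0.
Qed.

Lemma cLnorm0 : cLnorm (0 : cLspace mu p1) = 0.
Proof. by rewrite -(scale0r 0) cLnormZ ComplexField.Normc.normc0 mul0r. Qed.

Lemma cLnormN u : cLnorm (- u) = cLnorm u.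
Proof.
rewrite -scaleN1r cLnormZ -(rmorph1 (real_complex R)) -rmorphN normc_real.
by rewrite normrN1 mul1r.
Qed.

Lemma cLnorm_eq0 u : cLnorm u = 0 -> u = 0.
Proof.
elim/cLspaceW: u => f /(congr1 (@powR R ^~ r)).
rewrite powR_cLnorm powR0 ?gt_eqF// => If.
(* Written as a multiple of the class of f, zero becomes the class of an explicit function, as
   [cLspace_eqP] requires. *)
transitivity (0 *: \pi_(cLspace mu p1) f); last exact: scale0r.
rewrite -[_ *: _]/(cLspace_scale _ _) -cLspace_piZ; apply/cLspace_eqP.
have I := integrable_powR_normc f.
have /integrableP[mI _] := I.
have : (\int[mu]_(x in setT) `|(normc (f x) `^ r)%:E| = 0)%E.
  under eq_integral do rewrite gee0_abs ?lee_fin ?powR_ge0//.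
  by rewrite -[LHS]fineK ?integrable_fin_num// -[X in X%:E]/(Rintegral _ _ _) If.
move/(ae_eq_integral_abs mu measurableT mI).
apply: filterS => x /(_ Logic.I)/= [] /eqP.
rewrite powR_eq0 => /andP[/eqP /ComplexField.Normc.eq0_normc fx _].
by rewrite -[RHS]/(0 * f x) mul0r.
Qed.

Lemma cLnorm_gt0 u : (0 < cLnorm u) = (u != 0).
Proof.
rewrite lt0r cLnorm_ge0 andbT; apply/idP/idP; apply: contra_neq.
  by move=> ->; exact: cLnorm0.
exact: cLnorm_eq0.
Qed.

Lemma cLnormZ_real (k : R) u : 0 <= k -> cLnorm (k%:C%C *: u) = k * cLnorm u.
Proof. by move=> k0; rewrite cLnormZ normc_real ger0_norm. Qed.

Lemma cLnorm_normalize u : u != 0 -> cLnorm ((cLnorm u)^-1%:C%C *: u) = 1.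
Proof.
rewrite -cLnorm_gt0 => u0.
by rewrite cLnormZ_real ?invr_ge0 ?cLnorm_ge0// mulVf// gt_eqF.
Qed.

Lemma powR_half_cLnorm f :
  (cLnorm (\pi_(cLspace mu p1) f) / 2) `^ r =
  \int[mu]_x ((normc (f x) / 2) `^ r).
Proof.
rewrite powRM ?cLnorm_ge0 ?invr_ge0// powR_cLnorm.
rewrite -RintegralZr//; last exact: integrable_powR_normc.
by apply: eq_Rintegral => x _; rewrite powRM ?normc_ge0// invr_ge0.
Qed.

Lemma integrable_powR_half_normc f :
  mu.-integrable setT (fun x => ((normc (f x) / 2) `^ r)%:E).
Proof.
have := integrableZr measurableT (2^-1 `^ r) (integrable_powR_normc f).
apply: eq_integrable => // x _ /=.
by rewrite powRM ?normc_ge0 ?invr_ge0.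
Qed.

End one_space.

Section integrable_real.
Context d (T : measurableType d) (R : realType).
Variable mu : {measure set T -> \bar R}.
Implicit Types f g : T -> R.

Lemma integrable_EFinD f g : mu.-integrable setT (EFin \o f) ->
  mu.-integrable setT (EFin \o g) ->
  mu.-integrable setT (EFin \o (fun x => f x + g x)).
Proof. by move=> If Ig; exact: (integrableD measurableT If Ig). Qed.

Lemma integrable_EFinZl (k : R) f : mu.-integrable setT (EFin \o f) ->
  mu.-integrable setT (EFin \o (fun x => k * f x)).
Proof. by move=> If; exact: (integrableZl measurableT k If). Qed.

End integrable_real.

(** * Uniform convexity in the two ranges of the exponent *)

Section uniform_convexity.
Local Open Scope quotient_scope.
Context d (T : measurableType d) (R : realType).
Variables (mu : {measure set T -> \bar R}) (p : \bar R) (p1 : (1 <= p)%E).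
Variable r : R.
Hypotheses (pr : p = r%:E) (r1 : 1 < r).
Implicit Types (f g : cLfunType mu p1) (u v : cLspace mu p1).

Lemma normc_midpoint_le (z w : R[i]) : normc (z + w) / 2 <= (normc z + normc w) / 2.
Proof. by rewrite ler_pM2r ?invr_gt0//; exact: le_normcD. Qed.

Lemma cLspace_piB f g :
  \pi_(cLspace mu p1) (f - g) = \pi_(cLspace mu p1) f - \pi_(cLspace mu p1) g.
Proof. by rewrite cLspace_piD; congr (_ + _); exact: Quotient.pi_opp. Qed.

(* Integrating the pointwise inequality with a free parameter t and then taking
   t = D / 4 replaces Hoelder's inequality with weight (|f| + |g|) ^ (r - 2). *)
Lemma cLnorm_convex_le2 u v : r <= 2 -> cLnorm u = 1 -> cLnorm v = 1 ->
  (r - 1) ^+ 2 / 32 * cLnorm (u - v) ^+ 2 <= 2 - cLnorm (u + v).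
Proof.
elim/cLspaceW: u => f; elim/cLspaceW: v => g r2 f1 g1.
rewrite -cLspace_piD -cLspace_piB.
have iF := integrable_powR_normc pr r1 f.
have iG := integrable_powR_normc pr r1 g.
have iM := integrable_powR_half_normc pr r1 (f + g).
have iD := integrable_powR_half_normc pr r1 (f - g).
have EF : \int[mu]_x (normc (f x) `^ r) = 1 by rewrite -(powR_cLnorm pr r1) f1 powR1.
have EG : \int[mu]_x (normc (g x) `^ r) = 1 by rewrite -(powR_cLnorm pr r1) g1 powR1.
have EM := powR_half_cLnorm pr r1 (f + g).
have ED := powR_half_cLnorm pr r1 (f - g).
set M := cLnorm (\pi_(cLspace mu p1) (f + g)) in EM *.
set D := cLnorm (\pi_(cLspace mu p1) (f - g)) in ED *.
have M0 : 0 <= M by exact: cLnorm_ge0.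
have D0 : 0 <= D by exact: cLnorm_ge0.
set k := (r - 1) ^+ 2 / 2.
(* Both functions have norm 1, so the mean of a^r and b^r integrates to 1. *)
have key t : 0 < t ->
    (M / 2) `^ r + k * (t `^ (2 - r) * (D / 2) `^ r - t ^+ 2) <= 1.
  move=> t0; pose A := k * t `^ (2 - r); pose B := k * t ^+ 2 / 2.
  have : \int[mu]_x ((normc ((f + g) x) / 2) `^ r + A * ((normc ((f - g) x) / 2) `^ r))
      <= \int[mu]_x ((2^-1 + B) * (normc (f x) `^ r + normc (g x) `^ r)).
    apply: le_Rintegral => //.
    - by apply: integrable_EFinD => //; exact: integrable_EFinZl.
    - by apply: integrable_EFinZl; exact: integrable_EFinD.
    move=> x _; rewrite -subr_ge0.
    have := @powR_parallelogram_le2 R r _ _ _ _ t _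
      (normc_ge0 (f x)) (normc_ge0 (g x))
      (divr_ge0 (normc_ge0 ((f + g) x)) (ler0n R 2))
      (divr_ge0 (normc_ge0 ((f - g) x)) (ler0n R 2)) t0
      (normc_parallelogram (f x) (g x)) (normc_midpoint_le (f x) (g x)).
    rewrite r1 r2 -subr_ge0 => /(_ isT).
    by rewrite -/k; congr (0 <= _); rewrite /A /B; field.
  rewrite RintegralD//; last exact: integrable_EFinZl.
  rewrite RintegralZl// RintegralZl//; last exact: integrable_EFinD.
  rewrite RintegralD// EF EG -EM -ED -subr_ge0 => H.
  by rewrite -subr_ge0; move: H; congr (0 <= _); rewrite /A /B; field.
have k0 : 0 <= k by rewrite divr_ge0 ?sqr_ge0.
(* The choice t = D / 4 is positive only for D <> 0. *)
have [Dz|Dn] := eqVneq D 0.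
  have M2 : M = 2.
    move: Dz; rewrite /D cLspace_piB => /(cLnorm_eq0 pr r1)/eqP.
    rewrite subr_eq0 => /eqP fg.
    rewrite /M cLspace_piD -fg -mulr2n -scaler_nat (cLnormZ pr r1) f1 mulr1.
    by rewrite normcMn ComplexField.Normc.normc1.
  by rewrite M2 Dz expr0n/= mulr0 subrr.
have D4 : 0 < D / 4 by rewrite divr_gt0// lt0r Dn.
(* At t = D / 4 the product is 2^r t^2 >= 2 t^2, so t^2 = D^2 / 16 survives the subtraction in
   [key]. *)
have tD : D ^+ 2 / 8 <= (D / 4) `^ (2 - r) * (D / 2) `^ r.
  have -> : D / 2 = 2 * (D / 4) by field.
  rewrite (powRM r (ler0n R 2) (ltW D4)) mulrCA -powRD; last by rewrite subrK pnatr_eq0.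
  rewrite subrK (powR_mulrn _ (ltW D4)).
  have : 2 `^ 1 <= 2 `^ r :> R by apply: ler_powR; [exact: ler1n|exact: ltW].
  rewrite powRr1// => /(ler_wpM2r (sqr_ge0 (D / 4))).
  by apply: le_trans; rewrite le_eqVlt; apply/orP; left; apply/eqP; field.
have kM : (M / 2) `^ r + k * (D ^+ 2 / 16) <= 1.
  apply: le_trans (key _ D4); rewrite lerD2l ler_wpM2l//.
  rewrite lerBrDr; apply: le_trans tD; rewrite le_eqVlt; apply/orP; left.
  by apply/eqP; field.
have kD : 0 <= k * (D ^+ 2 / 16) by rewrite mulr_ge0// divr_ge0 ?sqr_ge0.
have h0 : 0 <= M / 2 by rewrite divr_ge0.
have M1 : M / 2 <= 1.
  rewrite leNgt; apply/negP => M1.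
  have : 1 `^ r < (M / 2) `^ r.
    by apply: gt0_ltr_powR; rewrite ?nnegrE//; apply: lt_trans r1.
  by rewrite powR1 ltNge (le_trans _ kM)// lerDl.
have Mr : (M / 2) ^+ 2 <= (M / 2) `^ r.
  move: h0; rewrite le_eqVlt => /predU1P[<-|h0].
    by rewrite expr0n/= powR_ge0.
  by rewrite -(powR_mulrn 2 (ltW h0)) ger_powR// h0.
(* Equivalently (M/2)^2 >= M - 1, which makes the bound linear in M. *)
have : (1 - M / 2) ^+ 2 >= 0 by exact: sqr_ge0.
have -> : (r - 1) ^+ 2 / 32 * D ^+ 2 = k * (D ^+ 2 / 16) by rewrite /k; field.
rewrite sqrrB expr1n mul1r; by move: (k * _) kM Mr => e; clear; lra.
Qed.

(** Clarkson's inequality, obtained by integrating [powR_parallelogram_ge2]. *)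
Lemma cLnorm_convex_ge2 u v : 2 <= r -> cLnorm u = 1 -> cLnorm v = 1 ->
  (cLnorm (u + v) / 2) `^ r + (cLnorm (u - v) / 2) `^ r <= 1.
Proof.
elim/cLspaceW: u => f; elim/cLspaceW: v => g r2 f1 g1.
rewrite -cLspace_piD -cLspace_piB.
have iF := integrable_powR_normc pr r1 f.
have iG := integrable_powR_normc pr r1 g.
have iM := integrable_powR_half_normc pr r1 (f + g).
have iD := integrable_powR_half_normc pr r1 (f - g).
have EF : \int[mu]_x (normc (f x) `^ r) = 1 by rewrite -(powR_cLnorm pr r1) f1 powR1.
have EG : \int[mu]_x (normc (g x) `^ r) = 1 by rewrite -(powR_cLnorm pr r1) g1 powR1.
rewrite !(powR_half_cLnorm pr r1) -RintegralD//.
apply: (@le_trans _ _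
  (\int[mu]_x (2^-1 * (normc (f x) `^ r + normc (g x) `^ r)))); last first.
  rewrite RintegralZl//; last exact: integrable_EFinD.
  by rewrite RintegralD// EF EG -mulr2n mulVf// pnatr_eq0.
apply: le_Rintegral => //.
- exact: integrable_EFinD.
- by apply: integrable_EFinZl; exact: integrable_EFinD.
move=> x _; rewrite [X in _ <= X]mulrC; apply: powR_parallelogram_ge2;
  rewrite ?divr_ge0 ?normc_ge0//.
exact: normc_parallelogram.
Qed.

End uniform_convexity.

(** * The real duality pairing, with Hoelder's and Minkowski's inequalities *)

Section pairing.
Local Open Scope quotient_scope.
Context d (T : measurableType d) (R : realType).
Variables (mu : {measure set T -> \bar R}) (p q : \bar R).
Variables (p1 : (1 <= p)%E) (q1 : (1 <= q)%E).

(** Real part of the duality pairing. The two exponents are independent, so that the spaces can be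
    exchanged; the type of [cpairing] fixes which one is the dual. *)
Definition rpair (u : cLspace mu p1) (v : cLspace mu q1) : R :=
  \int[mu]_x cdot (repr u x) (repr v x).

End pairing.

Lemma rpairC d (T : measurableType d) (R : realType)
    (mu : {measure set T -> \bar R}) (p q : \bar R)
    (p1 : (1 <= p)%E) (q1 : (1 <= q)%E)
    (u : cLspace mu p1) (v : cLspace mu q1) : rpair u v = rpair v u.
Proof.
by apply: eq_Rintegral => x _; rewrite /cdot mulrC [X in _ + X]mulrC.
Qed.

Section duality.
Local Open Scope quotient_scope.
Context d (T : measurableType d) (R : realType).
Variables (mu : {measure set T -> \bar R}) (p q : \bar R).
Variables (p1 : (1 <= p)%E) (q1 : (1 <= q)%E).
Variable r s : R.
Hypotheses (pr : p = r%:E) (qs : q = s%:E) (r1 : 1 < r) (s1 : 1 < s).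
Hypothesis rs : r^-1 + s^-1 = 1.
Implicit Types (f : cLfunType mu p1) (g : cLfunType mu q1).
Implicit Types (u : cLspace mu p1) (v : cLspace mu q1).

Let r0 : 0 < r. Proof. exact: lt_trans r1. Qed.
Let s0 : 0 < s. Proof. exact: lt_trans s1. Qed.

Lemma measurable_cdot f g : measurable_fun setT (fun x => cdot (f x) (g x)).
Proof.
have [rf imf] := cLfun_cmeasurable f; have [rg img] := cLfun_cmeasurable g.
by apply: measurable_funD; exact: measurable_funM.
Qed.

Lemma cdot_young (z w : R[i]) :
  `|cdot z w| <= r^-1 * normc z `^ r + s^-1 * normc w `^ s.
Proof.
apply: le_trans (cdot_norm z w) _; rewrite ![_^-1 * _]mulrC.
by apply: conjugate_powR; rewrite ?normc_ge0.
Qed.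

Let integrable_young f g : mu.-integrable setT
  (EFin \o (fun x => r^-1 * normc (f x) `^ r + s^-1 * normc (g x) `^ s)).
Proof.
apply: integrable_EFinD; apply: integrable_EFinZl.
  exact: integrable_powR_normc pr r1 f.
exact: integrable_powR_normc qs s1 g.
Qed.

Lemma integrable_cdot f g :
  mu.-integrable setT (EFin \o (fun x => cdot (f x) (g x))).
Proof.
apply: le_integrable (integrable_young f g) => //.
  by apply/measurable_EFinP; exact: measurable_cdot.
move=> x _ /=; rewrite lee_fin.
exact: le_trans (cdot_young (f x) (g x)) (ler_norm _).
Qed.

Lemma rpair_pi f g : rpair (\pi_(cLspace mu p1) f) (\pi_(cLspace mu q1) g) =
  \int[mu]_x cdot (f x) (g x).
Proof.
have fr : \forall x \ae mu, repr (\pi_(cLspace mu p1) f) x = f x.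
  by apply (proj1 (cLspace_eqP _ _)); rewrite reprK.
have gr : \forall x \ae mu, repr (\pi_(cLspace mu q1) g) x = g x.
  by apply (proj1 (cLspace_eqP _ _)); rewrite reprK.
congr fine; apply: ae_eq_integral => //.
- by apply/measurable_EFinP; exact: measurable_cdot.
- by apply/measurable_EFinP; exact: measurable_cdot.
by apply: filterS2 fr gr => x -> ->.
Qed.

Lemma rpairDl u u' v : rpair (u + u') v = rpair u v + rpair u' v.
Proof.
elim/cLspaceW: u => f; elim/cLspaceW: u' => f'; elim/cLspaceW: v => g.
rewrite -cLspace_piD !rpair_pi -RintegralD//; try exact: integrable_cdot.
apply: eq_Rintegral => x _; rewrite -[(f + f') x]/(f x + f' x) /cdot.
by case: (f x) (f' x) => [a b] [a' b'] /=; ring.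
Qed.

Lemma rpairZl (k : R) u v : rpair (k%:C%C *: u) v = k * rpair u v.
Proof.
elim/cLspaceW: u => f; elim/cLspaceW: v => g.
rewrite -[_ *: _]/(cLspace_scale _ (\pi_(cLspace mu p1) f)) -cLspace_piZ.
rewrite !rpair_pi -RintegralZl//; last exact: integrable_cdot.
apply: eq_Rintegral => x _; rewrite -[(_ *: f) x]/(k%:C%C * f x) /cdot.
by case: (f x) => [a b] /=; ring.
Qed.

(** Young's inequality integrates to 1/r + 1/s = 1 on unit vectors; Hoelder's inequality then
    follows by homogeneity. *)
Lemma rpair_unit_le u v : cLnorm u = 1 -> cLnorm v = 1 -> rpair u v <= 1.
Proof.
elim/cLspaceW: u => f; elim/cLspaceW: v => g f1 g1.
rewrite rpair_pi.
apply: (@le_trans _ _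
  (\int[mu]_x (r^-1 * normc (f x) `^ r + s^-1 * normc (g x) `^ s))).
  apply: le_Rintegral => //; first exact: integrable_cdot.
  by move=> x _; exact: le_trans (ler_norm _) (cdot_young _ _).
have iF := integrable_powR_normc pr r1 f.
have iG := integrable_powR_normc qs s1 g.
rewrite RintegralD//; try exact: integrable_EFinZl.
rewrite !RintegralZl// -(powR_cLnorm pr r1) -(powR_cLnorm qs s1) f1 g1.
by rewrite !powR1 !mulr1 rs.
Qed.

End duality.

Section duality2.
Local Open Scope quotient_scope.
Context d (T : measurableType d) (R : realType).
Variables (mu : {measure set T -> \bar R}) (p q : \bar R).
Variables (p1 : (1 <= p)%E) (q1 : (1 <= q)%E).
Variable r s : R.
Hypotheses (pr : p = r%:E) (qs : q = s%:E) (r1 : 1 < r) (s1 : 1 < s).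
Hypothesis rs : r^-1 + s^-1 = 1.
Implicit Types (u : cLspace mu p1) (v : cLspace mu q1).

Let r0 : 0 < r. Proof. exact: lt_trans r1. Qed.

Let sr : s^-1 + r^-1 = 1. Proof. by rewrite addrC. Qed.

Lemma rpairDr u v v' : rpair u (v + v') = rpair u v + rpair u v'.
Proof. by rewrite rpairC (rpairDl qs pr s1 r1 sr) !(rpairC u). Qed.

Lemma rpairZr (k : R) u v : rpair u (k%:C%C *: v) = k * rpair u v.
Proof. by rewrite rpairC (rpairZl qs pr s1 r1 sr) (rpairC u). Qed.

Lemma rpair_le u v : rpair u v <= cLnorm u * cLnorm v.
Proof.
have [->|u0] := eqVneq u 0.
  rewrite (cLnorm0 _ _ pr r1) mul0r -(scale0r 0).
  by rewrite -(rmorph0 (real_complex R)) (rpairZl pr qs r1 s1 rs) mul0r.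
have [->|v0] := eqVneq v 0.
  rewrite (cLnorm0 _ _ qs s1) mulr0 -(scale0r 0).
  by rewrite -(rmorph0 (real_complex R)) rpairZr mul0r.
have := rpair_unit_le pr qs r1 s1 rs
  (cLnorm_normalize pr r1 u0) (cLnorm_normalize qs s1 v0).
rewrite -(cLnorm_gt0 pr r1) in u0; rewrite -(cLnorm_gt0 qs s1) in v0.
rewrite (rpairZl pr qs r1 s1 rs) rpairZr mulrA.
by rewrite -invfM ler_pdivrMl ?mulr_gt0// mulr1.
Qed.

(* |f|^(r-2) f, normalised; at the zeros of f the product vanishes whatever
   the value of 0 `^ (r - 2). *)
Lemma exists_norming u : u != 0 -> exists2 v : cLspace mu q1, cLnorm v = 1 & rpair u v = cLnorm u.
Proof.
elim/cLspaceW: u => f; set n := cLnorm _; rewrite -(cLnorm_gt0 pr r1) -/n => n0.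
(* The factor n^(1-r) gives norm 1: since (r - 1) s = r, the power |h|^s equals n^(-r) |f|^r, whose
   integral is 1. *)
pose phi x := n `^ (1 - r) * normc (f x) `^ (r - 2).
pose h x := (phi x)%:C%C * f x.
have phi0 x : 0 <= phi x by rewrite mulr_ge0 ?powR_ge0.
have phif x : phi x * normc (f x) = n `^ (1 - r) * normc (f x) `^ (r - 1).
  rewrite -mulrA; congr (_ * _).
  have [->|] := eqVneq (normc (f x)) 0.
    by rewrite mulr0 powR0// subr_eq0 gt_eqF.
  move=> fx; rewrite -[X in _ * X](powRr1 (normc_ge0 _)) -powRD ?fx ?implybT//.
  by congr (_ `^ _); ring.
have normh x : normc (h x) = phi x * normc (f x).
  by rewrite ComplexField.Normc.normcM normc_real ger0_norm.
have rss : (r - 1) * s = r.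
  have rn : r != 0 by rewrite gt_eqF.
  have sn : s != 0 by rewrite gt_eqF// (lt_trans ltr01).
  apply/eqP; rewrite -subr_eq0.
  have -> : (r - 1) * s - r = r * s * (1 - (r^-1 + s^-1)) by field; apply/andP.
  by rewrite rs subrr mulr0.
have nh x : normc (h x) `^ s = n `^ (- r) * normc (f x) `^ r.
  rewrite normh phif powRM ?powR_ge0// -!powRrM rss; congr (_ `^ _ * _).
  by rewrite -[in RHS]rss; ring.
have [rf imf] := cLfun_cmeasurable f.
have mn : measurable_fun setT (fun x => normc (f x)).
  exact: measurable_normc (cLfun_cmeasurable f).
have mphi : measurable_fun setT phi.
  apply: measurable_funM; first exact: measurable_cst.
  exact: (measurableT_comp (measurable_powR _)).
have mh : cmeasurable h.
  split.
    rewrite (_ : (fun x => _) = (fun x => phi x * complex.Re (f x))).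
      exact: measurable_funM.
    by apply/funext => x; rewrite /h; case: (f x) => a b /=; ring.
  rewrite (_ : (fun x => _) = (fun x => phi x * complex.Im (f x))).
    exact: measurable_funM.
  by apply/funext => x; rewrite /h; case: (f x) => a b /=; ring.
have iF := integrable_powR_normc pr r1 f.
have hL : h \in cLfun mu q1.
  apply/cLfunP; split => //; rewrite /finite_norm qs unlock /Lnorm poweR_lty//.
  have /integrableP[_] : mu.-integrable setT
      (EFin \o (fun x => n `^ (- r) * normc (f x) `^ r)) by exact: integrable_EFinZl.
  congr (_ < _)%E; apply: eq_integral => x _ /=.
  by rewrite !ger0_norm ?normc_ge0 ?nh// mulr_ge0 ?powR_ge0.
pose H := CLfun hL.
exists (\pi_(cLspace mu q1) H).
  have sp : 0 < s by exact: lt_trans s1.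
  apply: (powR_injective sp); rewrite ?nnegrE ?cLnorm_ge0//.
  rewrite (powR_cLnorm qs s1) powR1.
  under eq_Rintegral => x _ do rewrite nh.
  rewrite RintegralZl// -(powR_cLnorm pr r1) -/n -powRD ?(gt_eqF n0) ?implybT//.
  by rewrite addNr powRr0.
rewrite rpair_pi.
transitivity (\int[mu]_x (n `^ (1 - r) * normc (f x) `^ r)).
  apply: eq_Rintegral => x _.
  have -> : cdot (f x) (H x) = phi x * normc (f x) ^+ 2.
    by rewrite sqr_normc -[H x]/(h x) /h /cdot; case: (f x) => a b /=; ring.
  rewrite expr2 mulrA phif -mulrA; congr (_ * _).
  by rewrite mulrC mulr_powRB1 ?normc_ge0.
rewrite RintegralZl// -(powR_cLnorm pr r1) -/n -powRD ?(gt_eqF n0) ?implybT//.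
by rewrite subrK powRr1 ?ltW.
Qed.

(** Minkowski's inequality by duality: pair both summands with a unit vector norming the sum. *)
Lemma ler_cLnormD u u' : cLnorm (u + u') <= cLnorm u + cLnorm u'.
Proof.
have [->|uu] := eqVneq (u + u') 0.
  by rewrite (cLnorm0 _ _ pr r1) addr_ge0 ?cLnorm_ge0.
have [v v1 <-] := exists_norming uu.
rewrite (rpairDl pr qs r1 s1 rs); apply: lerD.
  by apply: le_trans (rpair_le _ _) _; rewrite v1 mulr1.
by apply: le_trans (rpair_le _ _) _; rewrite v1 mulr1.
Qed.

End duality2.

(** * A modulus of uniform convexity *)

Section modulus.
Context {R : realType}.

Definition convexity_cst (r : R) : R := (r - 1) ^+ 2 / 32.

(* For r > 2 this comes from Clarkson's inequality and x ^ r >= 1 + r (x - 1). *)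
Definition convexity_modulus (r e : R) : R :=
  if r <= 2 then convexity_cst r * e ^+ 2 else 2 / r * (e / 2) `^ r.

Lemma convexity_cst_gt0 r : 1 < r -> 0 < convexity_cst r.
Proof. by move=> r1; rewrite divr_gt0// exprn_gt0// subr_gt0. Qed.

Lemma convexity_modulus_gt0 r e : 1 < r -> 0 < e -> 0 < convexity_modulus r e.
Proof.
move=> r1 e0; rewrite /convexity_modulus; case: ifPn => _.
  by rewrite mulr_gt0 ?exprn_gt0 ?convexity_cst_gt0.
by rewrite mulr_gt0 ?powR_gt0 ?divr_gt0// (lt_trans ltr01).
Qed.

(** Bernoulli's inequality, from the concave tangent bound at x^t with exponent 1/t. *)
Lemma powR_ge_tangent (x t : R) : 0 <= x -> 1 <= t -> 1 + t * (x - 1) <= x `^ t.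
Proof.
move=> x0 t1; have t0 : 0 < t by exact: lt_le_trans t1.
have := @powR_le_tangent _ (x `^ t) t^-1 (powR_ge0 _ _).
rewrite invr_ge0 (ltW t0) invf_le1// t1 -powRrM mulfV ?gt_eqF// powRr1// => /(_ isT).
rewrite -(ler_pM2l t0) mulrDr mulr1 mulVKf ?gt_eqF//; lra.
Qed.

End modulus.

Lemma cLnorm_uniformly_convex d (T : measurableType d) (R : realType)
    (mu : {measure set T -> \bar R}) (p : \bar R) (p1 : (1 <= p)%E) (r : R)
    (pr : p = r%:E) (r1 : 1 < r) (u v : cLspace mu p1) (e : R) :
  0 < e -> cLnorm u = 1 -> cLnorm v = 1 ->
  2 - convexity_modulus r e < cLnorm (u + v) -> cLnorm (u - v) < e.
Proof.
move=> e0 u1 v1; rewrite /convexity_modulus.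
have D0 : 0 <= cLnorm (u - v) by exact: cLnorm_ge0.
case: ifPn => [r2 uv|]; last first.
  rewrite -ltNge => r2 uv; rewrite ltNge; apply/negP => eD.
  have r0 : 0 < r by exact: lt_trans r1.
  have := cLnorm_convex_ge2 pr r1 (ltW r2) u1 v1.
  have M0 : 0 <= cLnorm (u + v) / 2 by rewrite divr_ge0// cLnorm_ge0.
  have : (e / 2) `^ r <= (cLnorm (u - v) / 2) `^ r.
    apply: ge0_ler_powR; rewrite ?nnegrE ?divr_ge0 ?(ltW r0) ?(ltW e0)//.
    by rewrite ler_pM2r ?invr_gt0.
  have := powR_ge_tangent M0 (ltW r1).
  move: uv; rewrite ltrBlDr -ltrBlDl -(ltr_pM2l r0).
  have -> : r * (2 / r * (e / 2) `^ r) = 2 * (e / 2) `^ r.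
    by rewrite mulrA [r * _]mulrC divfK// gt_eqF.
  move: ((e / 2) `^ r) ((cLnorm (u - v) / 2) `^ r) ((cLnorm (u + v) / 2) `^ r).
  by move: (cLnorm (u + v)) => M A B C; clear; lra.
have := cLnorm_convex_le2 pr r1 r2 u1 v1.
rewrite -/(convexity_cst r) => H.
rewrite -ltr_sqr ?nnegrE ?(ltW e0)// -(ltr_pM2l (convexity_cst_gt0 r1)).
by apply: le_lt_trans H _; rewrite ltrBlDr -ltrBlDl.
Qed.

(** * Operator norms and adjoints *)

Section opnorm.
Context dX dY (X : measurableType dX) (Y : measurableType dY) (R : realType).
Variables (mu : {measure set X -> \bar R}) (nu : {measure set Y -> \bar R}).
Variables (p q : \bar R) (p1 : (1 <= p)%E) (q1 : (1 <= q)%E) (r s : R).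
Hypotheses (pr : p = r%:E) (qs : q = s%:E) (r1 : 1 < r) (s1 : 1 < s).
Variable A : {linear cLspace mu p1 -> cLspace nu q1}.
Implicit Types u : cLspace mu p1.

Lemma opnorm_le K : (forall u, cLnorm u <= 1 -> cLnorm (A u) <= K) ->
  opnorm A <= K.
Proof.
move=> AK; apply: ge_sup => [|_ [u u1 <-]]; last exact: AK.
by exists (cLnorm (A 0)), 0 => //; rewrite /= (cLnorm0 _ _ pr r1).
Qed.

Hypothesis Ab : bounded_op A.

Lemma cLnorm_le_opnorm u : cLnorm (A u) <= opnorm A * cLnorm u.
Proof.
have [->|u0] := eqVneq u 0.
  by rewrite linear0 (cLnorm0 _ _ qs s1) (cLnorm0 _ _ pr r1) mulr0.
have u1 := cLnorm_normalize pr r1 u0.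
rewrite -(cLnorm_gt0 pr r1) in u0.
rewrite -ler_pdivrMr// mulrC.
have -> : (cLnorm u)^-1 * cLnorm (A u) = cLnorm (A ((cLnorm u)^-1%:C%C *: u)).
  by rewrite linearZ (cLnormZ_real qs s1)// invr_ge0 ltW.
apply: ub_le_sup; last by exists ((cLnorm u)^-1%:C%C *: u) => //=; rewrite u1.
(* The constant M may be negative, hence its absolute value as upper bound. *)
have [M AM] := Ab; exists `|M| => _ [v /= v1 <-].
apply: le_trans (AM v) _; apply: le_trans (ler_norm _) _.
by rewrite normrM ler_piMr// ger0_norm ?cLnorm_ge0.
Qed.

Lemma opnorm_ge0 : 0 <= opnorm A.
Proof.
have [M AM] := Ab; apply: ub_le_sup; last first.
  exists 0; rewrite /= ?(cLnorm0 _ _ pr r1)//.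
  by rewrite linear0 (cLnorm0 _ _ qs s1).
exists `|M| => _ [v /= v1 <-].
apply: le_trans (AM v) _; apply: le_trans (ler_norm _) _.
by rewrite normrM ler_piMr// ger0_norm ?cLnorm_ge0.
Qed.

End opnorm.

Section adjoint.
Context dX dY (X : measurableType dX) (Y : measurableType dY) (R : realType).
Variables (mu : {measure set X -> \bar R}) (nu : {measure set Y -> \bar R}).
Variables (p p' q q' : \bar R).
Variables (p1 : (1 <= p)%E) (p1' : (1 <= p')%E).
Variables (q1 : (1 <= q)%E) (q1' : (1 <= q')%E).
Variables r r' s s' : R.
Hypotheses (pr : p = r%:E) (pr' : p' = r'%:E) (qs : q = s%:E) (qs' : q' = s'%:E).
Hypotheses (r1 : 1 < r) (r1' : 1 < r') (s1 : 1 < s) (s1' : 1 < s').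
Hypotheses (rr : r^-1 + r'^-1 = 1) (ss : s^-1 + s'^-1 = 1).
Variable T : {linear cLspace mu p1 -> cLspace nu q1}.
Variable Ts : {linear cLspace nu q1' -> cLspace mu p1'}.
Hypothesis adj : forall f G, rpair (T f) G = rpair f (Ts G).
Hypothesis Tb : bounded_op T.

Let rr' : r'^-1 + r^-1 = 1. Proof. by rewrite addrC. Qed.

(** For a unit f norming Ts G, the norm of Ts G is the pairing of T f with G. *)
Lemma cLnorm_adjoint_le G : cLnorm (Ts G) <= opnorm T * cLnorm G.
Proof.
have [->|TG] := eqVneq (Ts G) 0.
  rewrite (cLnorm0 _ _ pr' r1') mulr_ge0 ?cLnorm_ge0//.
  exact: opnorm_ge0 pr qs r1 s1 T Tb.
have [f f1 <-] := exists_norming p1 pr' pr r1' r1 rr' TG.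
rewrite rpairC -adj; apply: le_trans (rpair_le qs qs' s1 s1' ss _ _) _.
apply: ler_wpM2r; first exact: cLnorm_ge0.
by have := cLnorm_le_opnorm pr qs r1 s1 Tb f; rewrite f1 mulr1.
Qed.

Lemma bounded_adjoint : bounded_op Ts.
Proof. by exists (opnorm T) => G; exact: cLnorm_adjoint_le. Qed.

Lemma opnorm_adjoint_le : opnorm Ts <= opnorm T.
Proof.
apply: (opnorm_le qs' s1') => G G1; apply: le_trans (cLnorm_adjoint_le G) _.
by rewrite ler_piMr// (opnorm_ge0 pr qs r1 s1 Tb).
Qed.

End adjoint.

(** * Real arithmetic behind the estimates *)

Section arithmetic.
Context {R : realFieldType}.

(** Serves [norming_stability]: U, V are the norms of u, v; x, y pair g with u, v; z pairs k with u;
    a, b, c pair g - k with u, v, u - v. Adding the two convexity bounds cancels b. *)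
Lemma norming_stability_arith (e U V W a b c x y z : R) :
  y = b + V -> x = a + z -> a = c + b -> c <= W ->
  y + V <= (2 - e) * V -> x + z <= (2 - e) * U ->
  e * (U + V) <= 2 * (U - x) + W.
Proof. by move=> *; lra. Qed.

(** Since U >= tau / 2, the left side of the last hypothesis is at least c tau D^2 / 2. Half of this
    absorbs D W by completing a square; dividing the rest by c tau / 4 produces the constants 8 and
    4. *)
Lemma extremiser_near_arith (c tau U V D t eta W : R) :
  0 < c -> 0 < tau -> W <= tau * eta -> t <= U -> tau / 2 <= t -> 0 <= V -> 0 <= D ->
  c * D ^+ 2 * (U + V) <= 2 * (U - t) + D * W ->
  D ^+ 2 <= 8 / (c * tau) * (U - t) + 4 / c ^+ 2 * eta ^+ 2.
Proof.
move=> c0 t0 We tU tt V0 D0 H.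
have cD : 0 <= c * D ^+ 2 by rewrite mulr_ge0 ?sqr_ge0 ?ltW.
have H1 : c * D ^+ 2 * (tau / 2) <= c * D ^+ 2 * (U + V) by apply: ler_wpM2l; lra.
have H2 : D * W <= D * (tau * eta) by apply: ler_wpM2l.
have cn : c != 0 by rewrite gt_eqF.
have tn : tau != 0 by rewrite gt_eqF.
have H3 : 0 <= tau / c * (c * D / 2 - eta) ^+ 2.
  by rewrite mulr_ge0 ?sqr_ge0// divr_ge0// ltW.
have E3 : tau / c * (c * D / 2 - eta) ^+ 2 =
    c * D ^+ 2 * tau / 4 - D * (tau * eta) + tau / c * eta ^+ 2 by field.
rewrite E3 in H3.
have ct : 0 < c * tau / 4 by rewrite divr_gt0// mulr_gt0.
rewrite -(ler_pM2l ct).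
have -> : c * tau / 4 * (8 / (c * tau) * (U - t) + 4 / c ^+ 2 * eta ^+ 2) =
  2 * (U - t) + tau / c * eta ^+ 2 by field; apply/andP.
have -> : c * tau / 4 * D ^+ 2 = c * D ^+ 2 * (tau / 2) / 2 by field.
have E4 : c * D ^+ 2 * tau / 4 = c * D ^+ 2 * (tau / 2) / 2 by field.
rewrite E4 in H3.
move: H1 H2 H3 H.
move: (c * D ^+ 2 * (tau / 2)) (c * D ^+ 2 * (U + V)) => e f.
move: (D * W) (D * (tau * eta)) (tau / c * eta ^+ 2) => x y z.
by clear; lra.
Qed.

Lemma image_lower_arith (tau n d ns x y : R) :
  0 <= tau -> n <= d + ns -> x = tau * ns -> x <= tau * d + y -> d <= 1 / 4 * n ->
  tau / 2 * n <= y.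
Proof.
move=> t0 H ->.
have := ler_wpM2l t0 H => H1 H2 /(ler_wpM2l t0) H3; move: H1 H2 H3.
rewrite mulrDr (mulrCA tau) (mulrAC tau); move: (tau * n) (tau * d) (tau * ns) => *; lra.
Qed.

(** Here x, y are the norms of T g, T gs, z pairs T g with Gs, and w is the norm of G + Gs. The
    total error is 2 tau d < m tau n / 2 <= m x, whence the 4 in m / 4. *)
Lemma norming_near_arith (tau n d m x y z w : R) :
  0 < tau -> 0 < n -> d < m / 4 * n -> tau / 2 * n <= x ->
  y <= tau * d + z -> x <= tau * d + y -> 0 <= m ->
  x + z <= x * w -> 2 - m < w.
Proof.
move=> t0 n0 dm tx yz xy m0 xw.
have x0 : 0 < x by apply: lt_le_trans tx; rewrite mulr_gt0// divr_gt0.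
rewrite -(ltr_pM2l x0); apply: lt_le_trans xw.
have H1 : m * (tau / 2 * n) <= m * x by exact: ler_wpM2l.
have : tau * d < tau * (m / 4 * n) by rewrite ltr_pM2l.
have E : m * (tau / 2 * n) = 2 * (tau * (m / 4 * n)) by field.
rewrite E in H1; rewrite mulrBr [x * m]mulrC.
move: H1 yz xy; clear; move: (tau * (m / 4 * n)) (tau * d) (m * x) => *; lra.
Qed.

(** If J is the squared distance from G to M(Ts), then i <= K1 d2 + K2 J and a J <= d1, so i <= K1
    d2 + (K2 / a) d1. *)
Lemma stability_arith (i K1 K2 a d1 d2 : R) :
  0 < K1 -> 0 < K2 -> 0 < a -> 0 <= d1 -> 0 <= d2 ->
  a * ((i - K1 * d2) / K2) <= d1 -> (K1 + K2 / a)^-1 * i <= d1 + d2.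
Proof.
move=> k1 k2 a0 d10 d20 H.
have b0 : 0 < K2 / a by rewrite divr_gt0.
rewrite ler_pdivrMl ?addr_gt0//.
have /(ler_wpM2l (ltW b0)) : a * ((i - K1 * d2) / K2) <= d1 by [].
have -> : K2 / a * (a * ((i - K1 * d2) / K2)) = i - K1 * d2.
  by field; rewrite !gt_eqF.
have : 0 <= K1 * d1 by rewrite mulr_ge0// ltW.
have : 0 <= K2 / a * d2 by rewrite mulr_ge0// ltW.
rewrite mulrDl !mulrDr; clear.
move: (K1 * d1) (K1 * d2) (K2 / a * d1) (K2 / a * d2) => *; lra.
Qed.

End arithmetic.

(** * Transfer of stability from the adjoint to the operator *)

Section stability.
Context dX dY (X : measurableType dX) (Y : measurableType dY) (R : realType).
Variables (mu : {measure set X -> \bar R}) (nu : {measure set Y -> \bar R}).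
Variables (p p' q q' : \bar R).
Variables (p1 : (1 <= p)%E) (p1' : (1 <= p')%E).
Variables (q1 : (1 <= q)%E) (q1' : (1 <= q')%E).
Variables r r' s s' : R.
Hypotheses (pr : p = r%:E) (pr' : p' = r'%:E) (qs : q = s%:E) (qs' : q' = s'%:E).
Hypotheses (r1 : 1 < r) (r1' : 1 < r') (s1 : 1 < s) (s1' : 1 < s').
Hypotheses (rr : r^-1 + r'^-1 = 1) (ss : s^-1 + s'^-1 = 1).
Variable T : {linear cLspace mu p1 -> cLspace nu q1}.
Variable Ts : {linear cLspace nu q1' -> cLspace mu p1'}.
Hypothesis adj : forall f G, rpair (T f) G = rpair f (Ts G).
Hypothesis Tb : bounded_op T.

Let rr' : r'^-1 + r^-1 = 1. Proof. by rewrite addrC. Qed.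
Let ss' : s'^-1 + s^-1 = 1. Proof. by rewrite addrC. Qed.
Let adj' : forall G f, rpair (Ts G) f = rpair G (T f).
Proof. by move=> G f; rewrite rpairC -adj rpairC. Qed.
Let Tsb : bounded_op Ts := bounded_adjoint pr pr' qs qs' r1 r1' s1 s1' rr ss adj Tb.

(** The one-sided bound is used twice, the second time with T as the adjoint of Ts. *)
Lemma opnorm_adjoint : opnorm Ts = opnorm T.
Proof.
apply/eqP; rewrite eq_le; apply/andP; split.
  exact: (opnorm_adjoint_le pr pr' qs qs' r1 r1' s1 s1' rr ss adj Tb).
exact: (opnorm_adjoint_le qs' qs pr' pr s1' s1 r1' r1 ss' rr' adj' Tsb).
Qed.

(** Pairing g with Ts G gives |T| |g|, which Hoelder bounds by |g| |Ts G|. *)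
Lemma norming_extremiser g G : extremisers T g -> cLnorm G = 1 ->
  rpair (T g) G = cLnorm (T g) -> extremisers Ts G.
Proof.
move=> [g0 Tg] G1 gG; split.
  by rewrite -(cLnorm_gt0 qs' s1') G1.
apply/eqP; rewrite G1 mulr1 eq_le; apply/andP; split.
  by have := cLnorm_le_opnorm qs' pr' s1' r1' Tsb G; rewrite G1 mulr1.
have := rpair_le pr pr' r1 r1' rr g (Ts G).
rewrite -adj gG Tg opnorm_adjoint mulrC ler_pM2l//.
by rewrite (cLnorm_gt0 pr r1).
Qed.

Lemma extremiser_scale (k : R) g : 0 < k -> extremisers T g ->
  extremisers T (k%:C%C *: g).
Proof.
move=> k0 [g0 Tg]; split.
  rewrite -(cLnorm_gt0 pr r1) (cLnormZ_real pr r1) ?(ltW k0)//.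
  by rewrite mulr_gt0// (cLnorm_gt0 pr r1).
rewrite linearZ (cLnormZ_real qs s1) ?(ltW k0)// (cLnormZ_real pr r1) ?(ltW k0)//.
by rewrite Tg mulrCA.
Qed.

Hypothesis r2 : r <= 2.

Local Notation kappa := (convexity_cst r).

(* Convexity bounds the pairings of g + k with u and with v from above, and
   Hoelder's inequality bounds that of g - k with u - v. *)
Lemma norming_stability (g k : cLspace mu p1) (u v : cLspace mu p1') :
  cLnorm g = 1 -> cLnorm k = 1 -> rpair k v = cLnorm v ->
  kappa * cLnorm (g - k) ^+ 2 * (cLnorm u + cLnorm v) <=
  2 * (cLnorm u - rpair g u) + cLnorm (g - k) * cLnorm (u - v).
Proof.
move=> g1 k1 kv.
have := cLnorm_convex_le2 pr r1 r2 g1 k1; rewrite -/kappa => conv.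
have bound (w : cLspace mu p1') : rpair g w + rpair k w <= (2 - kappa * cLnorm (g - k) ^+ 2) * cLnorm w.
  rewrite -(rpairDl pr pr' r1 r1' rr).
  apply: le_trans (rpair_le pr pr' r1 r1' rr _ _) _.
  by rewrite ler_wpM2r ?cLnorm_ge0// lerBrDl -lerBrDr.
have := bound u; have := bound v; rewrite kv.
have := rpair_le pr pr' r1 r1' rr (g - k) (u - v).
have : rpair (g - k) u = rpair (g - k) (u - v) + rpair (g - k) v.
  by rewrite -(rpairDr pr pr' r1 r1' rr) subrK.
have : rpair g u = rpair (g - k) u + rpair k u.
  by rewrite -(rpairDl pr pr' r1 r1' rr) subrK.
have : rpair g v = rpair (g - k) v + rpair k v.
  by rewrite -(rpairDl pr pr' r1 r1' rr) subrK.
rewrite kv => E1 E2 E3 E4 E5 E6.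
exact: norming_stability_arith E1 E2 E3 E4 E5 E6.
Qed.

(** No closeness of G to Gs is assumed, so the bound can later be optimised over all Gs. The witness
    is k rescaled to the norm of g. *)
Lemma extremiser_near (g : cLspace mu p1) (G Gs : cLspace nu q1') :
  0 < opnorm T -> g != 0 -> cLnorm G = 1 -> rpair (T g) G = cLnorm (T g) ->
  opnorm T / 2 * cLnorm g <= cLnorm (T g) -> extremisers Ts Gs ->
  exists2 gs, extremisers T gs &
   (cLnorm (g - gs) / cLnorm g) ^+ 2 <=
     8 / (kappa * opnorm T) * (cLnorm (Ts G) - cLnorm (T g) / cLnorm g)
     + 4 / kappa ^+ 2 * cLnorm (G - Gs) ^+ 2.
Proof.
move=> t0 g0 G1 gG Tg_ge Gsx.
have := Gsx => -[Gs0 TGs].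
have n0 : 0 < cLnorm g by rewrite (cLnorm_gt0 pr r1).
have v0 : Ts Gs != 0.
  rewrite -(cLnorm_gt0 pr' r1') TGs opnorm_adjoint mulr_gt0//.
  by rewrite (cLnorm_gt0 qs' s1').
have [k k1 kv] := exists_norming p1 pr' pr r1' r1 rr' v0.
have kx : extremisers T k.
  have [k0 Tk] : extremisers T k.
    split; first by rewrite -(cLnorm_gt0 pr r1) k1.
    apply/eqP; rewrite eq_le (cLnorm_le_opnorm pr qs r1 s1 Tb)/= k1 mulr1.
    have := rpair_le qs qs' s1 s1' ss (T k) Gs.
    rewrite adj rpairC kv TGs opnorm_adjoint ler_pM2r//.
    by rewrite (cLnorm_gt0 qs' s1').
  by split.
exists ((cLnorm g)%:C%C *: k); first exact: extremiser_scale.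
pose h := (cLnorm g)^-1%:C%C *: g.
have h1 : cLnorm h = 1 by exact: cLnorm_normalize pr r1 _ g0.
have gh : g = (cLnorm g)%:C%C *: h.
  by rewrite /h scalerA -rmorphM/= mulfV ?gt_eqF// rmorph1 scale1r.
have -> : cLnorm (g - (cLnorm g)%:C%C *: k) / cLnorm g = cLnorm (h - k).
  rewrite {1}gh -scalerBr (cLnormZ_real pr r1) ?(ltW n0)//.
  by rewrite mulrAC mulfV ?mul1r// gt_eqF.
have hG : rpair h (Ts G) = cLnorm (T g) / cLnorm g.
  by rewrite /h (rpairZl pr pr' r1 r1' rr) -adj gG mulrC.
have := @norming_stability h k (Ts G) (Ts Gs) h1 k1.
rewrite rpairC => /(_ kv); rewrite hG.
set U := cLnorm (Ts G); set V := cLnorm (Ts Gs); set D := cLnorm (h - k).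
set t := cLnorm (T g) / _; set eta := cLnorm (G - Gs).
have tU : t <= U.
  by rewrite /t -hG; have := rpair_le pr pr' r1 r1' rr h (Ts G); rewrite h1 mul1r.
have tt : opnorm T / 2 <= t by rewrite /t ler_pdivlMr.
have V0 : 0 <= V by exact: cLnorm_ge0.
have D0 : 0 <= D by exact: cLnorm_ge0.
have W : cLnorm (Ts G - Ts Gs) <= opnorm T * eta.
  rewrite -linearB.
  exact: (cLnorm_adjoint_le pr pr' qs qs' r1 r1' s1 s1' rr ss adj Tb).
have kap : 0 < kappa by exact: convexity_cst_gt0.
exact: extremiser_near_arith.
Qed.

Section near_extremiser.
Variables g gs : cLspace mu p1.
Hypotheses (g0 : g != 0) (gsx : extremisers T gs).

Let n0 : 0 < cLnorm g. Proof. by rewrite (cLnorm_gt0 pr r1). Qed.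

Let Tdist : cLnorm (T (g - gs)) <= opnorm T * cLnorm (g - gs).
Proof. exact: (cLnorm_le_opnorm pr qs r1 s1 Tb). Qed.

(** The triangle inequality, used in both spaces, loses 2 |T| |g - gs|; the threshold 1/4 makes this
    at most half of |T| |g|. *)
Lemma image_lower : cLnorm (g - gs) <= 1 / 4 * cLnorm g ->
  opnorm T / 2 * cLnorm g <= cLnorm (T g).
Proof.
have [gs0 Tgs] := gsx.
apply: (image_lower_arith _ _ Tgs); first exact: (opnorm_ge0 pr qs r1 s1 Tb).
  by rewrite -{1}(subrK gs g); exact: (ler_cLnormD p1' pr pr' r1 r1' rr).
have -> : T gs = T (gs - g) + T g by rewrite -linearD subrK.
apply: le_trans (ler_cLnormD q1' qs qs' s1 s1' ss _ _) _.
by rewrite lerD2r -opprB linearN (cLnormN qs s1).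
Qed.

(** Gs norms T gs. As T g is close to T gs, the pairing of T g with G + Gs is nearly 2 |T g|, so G +
    Gs has norm nearly 2 and uniform convexity applies. *)
Lemma norming_near (e : R) (G : cLspace nu q1') : 0 < opnorm T -> 0 < e ->
  cLnorm (g - gs) < Num.min (1 / 4) (convexity_modulus s' e / 4) * cLnorm g ->
  cLnorm G = 1 -> rpair (T g) G = cLnorm (T g) ->
  exists2 Gs, extremisers Ts Gs & cLnorm (G - Gs) < e.
Proof.
move=> t0 e0; rewrite -ltr_pdivrMr// lt_min !ltr_pdivrMr// => /andP[d4 dm] G1 gG.
have [gs0 Tgs] := gsx.
have Tgs0 : T gs != 0.
  by rewrite -(cLnorm_gt0 qs s1) Tgs mulr_gt0// (cLnorm_gt0 pr r1).
have [Gs Gs1 gsGs] := exists_norming q1' qs qs' s1 s1' ss Tgs0.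
exists Gs; first exact: (norming_extremiser gsx Gs1 gsGs).
apply: (cLnorm_uniformly_convex qs' s1' e0 G1 Gs1).
have Tsub : cLnorm (T (gs - g)) <= opnorm T * cLnorm (g - gs).
  by rewrite -opprB linearN (cLnormN qs s1).
have gsG : cLnorm (T gs) <= opnorm T * cLnorm (g - gs) + rpair (T g) Gs.
  have -> : cLnorm (T gs) = rpair (T (gs - g)) Gs + rpair (T g) Gs.
    by rewrite -(rpairDl qs qs' s1 s1' ss) -linearD subrK.
  rewrite lerD2r; apply: le_trans (rpair_le qs qs' s1 s1' ss _ _) _.
  by rewrite Gs1 mulr1; exact: Tsub.
have Tggs : cLnorm (T g) <= opnorm T * cLnorm (g - gs) + cLnorm (T gs).
  have {1}-> : T g = T (g - gs) + T gs by rewrite -linearD subrK.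
  apply: le_trans (ler_cLnormD q1' qs qs' s1 s1' ss _ _) _.
  by rewrite lerD2r.
have m0 := ltW (convexity_modulus_gt0 s1' e0).
apply: (norming_near_arith t0 n0 dm (image_lower (ltW d4)) gsG Tggs m0).
have := rpair_le qs qs' s1 s1' ss (T g) (G + Gs).
by rewrite (rpairDr qs qs' s1 s1' ss) gG.
Qed.

End near_extremiser.

Lemma stability_from_adjoint (c1 a : R) : 0 < c1 -> 0 < a ->
  (forall G, G != 0 ->
     (ereal_inf [set (cLnorm (G - Gs) / cLnorm G)%:E
                | Gs in extremisers Ts] < c1%:E)%E ->
     ((opnorm T - cLnorm (Ts G) / cLnorm G)%:E >=
       a%:E * ereal_inf [set ((cLnorm (G - Gs) / cLnorm G) ^+ 2)%:E
                        | Gs in extremisers Ts])%E) ->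
  exists2 b : R, 0 < b &
    forall g, g != 0 ->
      (ereal_inf [set (cLnorm (g - gs) / cLnorm g)%:E
                 | gs in extremisers T] <
         (Num.min (1 / 4) (convexity_modulus s' c1 / 4))%:E)%E ->
      ((opnorm T - cLnorm (T g) / cLnorm g)%:E >=
        b%:E * ereal_inf [set ((cLnorm (g - gs) / cLnorm g) ^+ 2)%:E
                         | gs in extremisers T])%E.
Proof.
move=> c10 a0 H.
(* When T has norm 0, every nonzero g is an extremiser, so the infimum is at most 0 and any b
   works. *)
have := opnorm_ge0 pr qs r1 s1 Tb; rewrite le_eqVlt => /predU1P[tz|t0].
  exists 1 => // g g0 _; rewrite mul1e.
  have Tg : cLnorm (T g) = 0.
    apply/eqP; rewrite eq_le cLnorm_ge0 andbT.
    by have := cLnorm_le_opnorm pr qs r1 s1 Tb g; rewrite -tz mul0r.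
  apply: ereal_inf_lbound; exists g; first by split=> //; rewrite Tg -tz mul0r.
  by rewrite -tz Tg mul0r subrr subrr (cLnorm0 _ _ pr r1) mul0r expr0n.
set K1 := 8 / (kappa * opnorm T); set K2 := 4 / kappa ^+ 2.
have kap : 0 < kappa by exact: convexity_cst_gt0.
have K10 : 0 < K1 by rewrite divr_gt0// mulr_gt0.
have K20 : 0 < K2 by rewrite divr_gt0// exprn_gt0.
exists (K1 + K2 / a)^-1; first by rewrite invr_gt0 addr_gt0// divr_gt0.
move=> g g0 /ereal_inf_lt[_ [gs gsx <-]]; rewrite lte_fin.
have n0 : 0 < cLnorm g by rewrite (cLnorm_gt0 pr r1).
rewrite ltr_pdivrMr// => near.
have near4 : cLnorm (g - gs) <= 1 / 4 * cLnorm g.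
  by rewrite ltW// (lt_le_trans near)// ler_wpM2r ?(ltW n0)// ge_min lexx.
have Tg_ge := image_lower gsx near4.
have Tg0 : T g != 0.
  rewrite -(cLnorm_gt0 qs s1); apply: lt_le_trans Tg_ge.
  by rewrite mulr_gt0// divr_gt0.
have [G G1 gG] := exists_norming q1' qs qs' s1 s1' ss Tg0.
have G0 : G != 0 by rewrite -(cLnorm_gt0 qs' s1') G1.
have [Gs Gsx GGs] := norming_near g0 gsx t0 c10 near G1 gG.
set d2 := cLnorm (Ts G) - cLnorm (T g) / cLnorm g.
set d1 := opnorm T - cLnorm (Ts G).
have d10 : 0 <= d1.
  rewrite subr_ge0.
  have := cLnorm_adjoint_le pr pr' qs qs' r1 r1' s1 s1' rr ss adj Tb G.
  by rewrite G1 mulr1.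
have d20 : 0 <= d2.
  rewrite subr_ge0 ler_pdivrMr// mulrC.
  by have := rpair_le pr pr' r1 r1' rr g (Ts G); rewrite -adj gG.
set I := ereal_inf _.
have I0 : (0 <= I)%E.
  by apply: le_ereal_inf_tmp => _ [x _ <-]; rewrite lee_fin sqr_ge0.
have Ile x : extremisers T x -> (I <= ((cLnorm (g - x) / cLnorm g) ^+ 2)%:E)%E.
  by move=> xx; apply: ereal_inf_lbound; exists x.
(* M(T) contains gs, so the infimum is finite and the claim becomes one about reals. *)
have Ifin : I \is a fin_num.
  by rewrite ge0_fin_numE//; apply: le_lt_trans (Ile _ gsx) _; rewrite ltry.
rewrite -(fineK Ifin) -EFinM lee_fin; set i := fine I.
have -> : opnorm T - cLnorm (T g) / cLnorm g = d1 + d2 by rewrite /d1 /d2; ring.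
apply: (stability_arith K10 K20 a0 d10 d20).
have infG : (ereal_inf [set (cLnorm (G - Gs) / cLnorm G)%:E
    | Gs in extremisers Ts] < c1%:E)%E.
  apply/ereal_inf_ltP; exists (cLnorm (G - Gs) / cLnorm G)%:E; first by exists Gs.
  by rewrite G1 divr1 lte_fin.
rewrite -lee_fin; have := H G G0 infG; rewrite G1 divr1 -/d1; apply: le_trans.
rewrite EFinM; apply: lee_wpmul2l; first by rewrite lee_fin ltW.
(* Each Gt in M(Ts) yields an extremiser of T at distance controlled by [extremiser_near]; hence (i
   - K1 d2) / K2 bounds all squared distances from G below. *)
apply: le_ereal_inf_tmp => _ [Gt Gtx <-]; rewrite lee_fin ler_pdivrMr// lerBlDl.
have [x xx xle] := extremiser_near t0 g0 G1 gG Tg_ge Gtx.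
rewrite divr1 [_ * K2]mulrC; apply: le_trans xle.
by rewrite -lee_fin fineK// Ile.
Qed.

End stability.

Section hoelder_conjugate_real.
Context {R : realType} (q : R).
Hypothesis q1 : 1 < q.

Lemma hoelder_conjugate_EFin : hoelder_conjugate q%:E = (q / (q - 1))%:E.
Proof.
have q0 : q != 0 by rewrite gt_eqF// (lt_trans ltr01).
have qn : q - 1 != 0 by rewrite subr_eq0 gt_eqF.
by rewrite /hoelder_conjugate eqe (negbTE q0) EFinM -EFinD inver (negbTE qn).
Qed.

Lemma conjugate_gt1 : 1 < q / (q - 1).
Proof. by rewrite ltr_pdivlMr ?subr_gt0// mul1r gtrBl. Qed.

Lemma conjugate_sum : q^-1 + (q / (q - 1))^-1 = 1.
Proof.
rewrite invf_div; field; rewrite gt_eqF//; exact: lt_trans q1.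
Qed.

End hoelder_conjugate_real.

Lemma Re_cpairing d (T : measurableType d) (R : realType)
    (mu : {measure set T -> \bar R}) (p : \bar R) (p1 : (1 <= p)%E)
    (u : cLspace mu p1) (v : cLspace mu (hoelder_conj_ge1 p1)) :
  complex.Re (cpairing u v) = rpair u v.
Proof. by apply: eq_Rintegral => x _; rewrite cdotE. Qed.

Theorem theorem5 (R : realType) :
  exists c2 : R -> R -> R -> R -> R,
  forall (dX dY : measure_display)
    (X : measurableType dX) (Y : measurableType dY)
    (mu : {measure set X -> \bar R}) (nu : {measure set Y -> \bar R})
    (p q : R) (p1 : (1 <= p%:E)%E) (q1 : (1 <= q%:E)%E)
    (T : {linear cLspace mu p1 -> cLspace nu q1})
    (Ts : {linear cLspace nu (hoelder_conj_ge1 q1) ->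
                  cLspace mu (hoelder_conj_ge1 p1)})
    (c1 a : R),
  1 < p -> p <= 2 -> 1 < q ->
  bounded_op T -> is_adjoint T Ts ->
  0 < c1 -> c1 <= 1 -> 0 < a ->
  (forall G, G != 0 ->
     (ereal_inf [set (cLnorm (G - Gs) / cLnorm G)%:E
                | Gs in extremisers Ts] < c1%:E)%E ->
     ((opnorm T - cLnorm (Ts G) / cLnorm G)%:E >=
       a%:E * ereal_inf [set ((cLnorm (G - Gs) / cLnorm G) ^+ 2)%:E
                        | Gs in extremisers Ts])%E) ->
  0 < c2 p q (opnorm T) c1 <= 1 /\
  exists2 b : R, 0 < b &
    forall g, g != 0 ->
      (ereal_inf [set (cLnorm (g - gs) / cLnorm g)%:E
                 | gs in extremisers T] < (c2 p q (opnorm T) c1)%:E)%E ->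
      ((opnorm T - cLnorm (T g) / cLnorm g)%:E >=
        b%:E * ereal_inf [set ((cLnorm (g - gs) / cLnorm g) ^+ 2)%:E
                         | gs in extremisers T])%E.
Proof.
(* The threshold of [norming_near] at e = c1 for the conjugate exponent of q; the cap 1/4, needed by
   [image_lower], also keeps c2 below 1. *)
exists (fun _ q _ c1 => Num.min (1 / 4) (convexity_modulus (q / (q - 1)) c1 / 4)).
move=> dX dY X Y mu nu p q p1 q1 T Ts c1 a p_gt1 p_le2 q_gt1 Tb TTs c10 c11 a0 H.
split.
  rewrite lt_min divr_gt0// divr_gt0 ?convexity_modulus_gt0 ?conjugate_gt1//=.
  by rewrite ge_min; apply/orP; left; rewrite ler_pdivrMr// mul1r ler1n.
have adj f G : rpair (T f) G = rpair f (Ts G).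
  by rewrite -!Re_cpairing TTs.
exact: (stability_from_adjoint erefl (hoelder_conjugate_EFin p_gt1) erefl
  (hoelder_conjugate_EFin q_gt1) p_gt1 (conjugate_gt1 p_gt1) q_gt1
  (conjugate_gt1 q_gt1) (conjugate_sum p_gt1) (conjugate_sum q_gt1) adj Tb p_le2
  c10 a0 H).
Qed.
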